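(* Let $f_i(x)=\max\{a_ix+b_i,c_i\}$ for constants $a_i\ge 0$, $b_i$, $c_i$ ($i\in[n]$). Then the maximum partial composition ordering problem for $(f_1,\dots,f_n)$ and any initial constant $c\in\mathbb{R}$ is solvable in $O(n^2)$ time.
   Context: Let $[n]=\{1,\dots,n\}$. Given real functions $f_1,\dots,f_n:\mathbb{R}\to\mathbb{R}$ and a constant $c\in\mathbb{R}$, the maximum partial composition ordering problem asks for a permutation $\sigma:[n]\to[n]$ and an integer $k$ with $0\le k\le n$ maximizing $f_{\sigma(k)}\circ\dots\circ f_{\sigma(1)}(c)$ (for $k=0$ the value is $c$). *)

(* Defs.v *)
From mathcomp Require Import all_boot all_order all_algebra all_fingroup.
From mathcomp Require Import reals.
Set Implicit Arguments.
Unset Strict Implicit.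
Unset Printing Implicit Defensive.
Import Order.TTheory GRing.Theory Num.Theory.
Local Open Scope ring_scope.

Section Problem.
Variables (R : realType) (n : nat).
Implicit Types (f : 'I_n -> R -> R) (sigma : {perm 'I_n}) (k : nat).

(* f_{sigma(k)} o ... o f_{sigma(1)} (c); the indices are 0, ..., n-1 here, so
   the functions applied are those of index sigma 0, ..., sigma (k-1). *)
Definition partial_composition f (c : R) sigma k : R :=
  foldl (fun x i => f i x) c (take k [seq sigma i | i <- enum 'I_n]).

Definition max_partial_composition f (c : R) sigma k : Prop :=
  (k <= n)%N /\
  forall (tau : {perm 'I_n}) (l : nat), (l <= n)%N ->
    partial_composition f c tau l <= partial_composition f c sigma k.

End Problem.

(* Running time is measured on a unit-cost real RAM, given by structured
   programs; replacing the control structures by jumps yields an ordinary RAM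
   program that is slower by at most a constant factor.  A program is a fixed
   finite object that contains no real parameter and does not depend on the
   input size.  Index registers and index cells hold natural numbers, real
   registers and real cells hold exact reals, and there is no conversion (in
   particular no rounding) from reals to naturals.  Registers and arrays are
   named by literals occurring in the program; only positions inside an array
   can be computed. *)

Variant arith := Add | Sub | Mul | Div.

(* In the comments below x, y, z are registers, A is an array. *)
Variant instr :=
  | NConst of nat & nat              (* x := m            *)
  | NAdd of nat & nat & nat          (* x := y + z        *)
  | NSub of nat & nat & nat          (* x := max(y - z, 0) *)
  | NLoad of nat & nat & nat         (* x := A[y]         *)
  | NStore of nat & nat & nat        (* A[y] := x         *)
  | RConst of nat & nat              (* x := m            *)
  | RArith of arith & nat & nat & nat (* x := y op z       *)
  | RLoad of nat & nat & nat         (* x := A[y], y an index register *)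
  | RStore of nat & nat & nat.       (* A[y] := x, y an index register *)

Variant test :=
  | NLt of nat & nat
  | RLt of nat & nat.

Inductive prog :=
  | Skip
  | Do of instr
  | Seq of prog & prog
  | If of test & prog & prog
  | While of test & prog.

Section Machine.
Variable R : realType.

Record state := State {
  nreg : nat -> nat;
  narr : nat -> nat -> nat;
  rreg : nat -> R;
  rarr : nat -> nat -> R }.

Definition upd (T : Type) (g : nat -> T) (x : nat) (v : T) : nat -> T :=
  fun y => if y == x then v else g y.

Definition upd2 (T : Type) (g : nat -> nat -> T) (A j : nat) (v : T) :=
  upd g A (upd (g A) j v).

Definition set_nreg s x v := State (upd (nreg s) x v) (narr s) (rreg s) (rarr s).
Definition set_narr s A j v :=
  State (nreg s) (upd2 (narr s) A j v) (rreg s) (rarr s).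
Definition set_rreg s x v := State (nreg s) (narr s) (upd (rreg s) x v) (rarr s).
Definition set_rarr s A j v :=
  State (nreg s) (narr s) (rreg s) (upd2 (rarr s) A j v).

(* Division by zero returns 0. *)
Definition arith_sem (op : arith) (u v : R) : R :=
  match op with Add => u + v | Sub => u - v | Mul => u * v | Div => u / v end.

Definition instr_sem (i : instr) (s : state) : state :=
  match i with
  | NConst x m => set_nreg s x m
  | NAdd x y z => set_nreg s x (nreg s y + nreg s z)%N
  | NSub x y z => set_nreg s x (nreg s y - nreg s z)%N
  | NLoad x A y => set_nreg s x (narr s A (nreg s y))
  | NStore A y x => set_narr s A (nreg s y) (nreg s x)
  | RConst x m => set_rreg s x m%:R
  | RArith op x y z => set_rreg s x (arith_sem op (rreg s y) (rreg s z))
  | RLoad x A y => set_rreg s x (rarr s A (nreg s y))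
  | RStore A y x => set_rarr s A (nreg s y) (rreg s x)
  end.

Definition test_sem (b : test) (s : state) : bool :=
  match b with
  | NLt x y => (nreg s x < nreg s y)%N
  | RLt x y => rreg s x < rreg s y
  end.

(* exec p s t s' : started in s, the program p halts in s' after t steps, each
   instruction and each evaluation of a test being one step. *)
Inductive exec : prog -> state -> nat -> state -> Prop :=
  | exec_Skip s : exec Skip s 1 s
  | exec_Do i s : exec (Do i) s 1 (instr_sem i s)
  | exec_Seq p q s1 s2 s3 t u :
      exec p s1 t s2 -> exec q s2 u s3 -> exec (Seq p q) s1 (t + u) s3
  | exec_IfT b p q s t s' :
      test_sem b s -> exec p s t s' -> exec (If b p q) s t.+1 s'
  | exec_IfF b p q s t s' :
      ~~ test_sem b s -> exec q s t s' -> exec (If b p q) s t.+1 s'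
  | exec_WhileT b p s1 s2 s3 t u :
      test_sem b s1 -> exec p s1 t s2 -> exec (While b p) s2 u s3 ->
      exec (While b p) s1 (t + u).+1 s3
  | exec_WhileF b p s : ~~ test_sem b s -> exec (While b p) s 1 s.

Lemma exec_det p s t s' u s'' :
  exec p s t s' -> exec p s u s'' -> t = u /\ s' = s''.
Proof.
move=> H; elim: H u s'' => {p s t s'}
  [s|i s|p q s1 s2 s3 t u _ IHp _ IHq|b p q s t s' Hb _ IH|b p q s t s' Hb _ IH
  |b p s1 s2 s3 t u Hb _ IHp _ IHw|b p s Hb] v r H; inversion H; subst => //;
  repeat match goal with
  | [ h1 : is_true (test_sem ?b ?s), h2 : is_true (~~ test_sem ?b ?s) |- _ ] =>
      by rewrite h1 in h2
  | [ IH : forall u s, exec ?p ?s0 u s -> _ /\ _, h : exec ?p ?s0 _ _ |- _ ] =>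
      by have [-> ->] := IH _ _ h
  | [ IH : forall u s, exec ?p ?s0 u s -> _ /\ _, h : exec ?p ?s0 _ _ |- _ ] =>
      have [? ?] := IH _ _ h; clear IH; subst
  end.
Qed.

(* Cells beyond the end of a vector hold 0. *)
Definition cells (n : nat) (v : 'I_n -> R) (j : nat) : R := oapp v 0 (insub j).

(* Index register 0 holds n, real register 0 holds the initial constant, and
   the real arrays 0, 1, 2 hold the coefficients a, b, c of the functions; all
   other registers and cells are 0. *)
Definition input (n : nat) (a b c : 'I_n -> R) (x0 : R) : state :=
  State (upd (fun=> 0%N) 0 n)
        (fun _ _ => 0%N)
        (upd (fun=> 0) 0 x0)
        (fun A => nth (fun=> 0) [:: cells a; cells b; cells c] A).

(* The answer is read off the index memory: k in register 0 and the values of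
   sigma in the first n cells of array 0. *)
Definition outputs (s : state) (n : nat) (sigma : {perm 'I_n}) (k : nat) : Prop :=
  nreg s 0 = k /\ forall i : 'I_n, narr s 0 i = sigma i :> nat.

End Machine.

(* Main.v *)
(* Since all functions are nondecreasing, cutting a composition after the last
   place where a constant c_s is the maximum shows that the optimum is reached
   by starting from x0, or by applying f_s first and going on from c_s, and then
   using the linear parts a_i x + b_i only; any such choice is a lower bound for
   the true composition.  For the linear parts, replace each of them by
   x |-> max (x, a_i x + b_i), which amounts to leaving out useless functions.
   These maps can be sorted once and for all: slopes < 1 first, then slope 1, then
   slopes > 1, and by increasing fixed point b_i / (1 - a_i) inside the first and
   the last class; swapping two neighbours into this order never decreases the
   result at any point.  So one sort, followed by one linear scan for each of the
   n + 1 starting values, takes time O(n^2). *)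
Require Import Defs.
From mathcomp Require Import all_boot all_order all_algebra all_fingroup.
From mathcomp Require Import reals.
From mathcomp Require Import lra zify.
Set Implicit Arguments.
Unset Strict Implicit.
Unset Printing Implicit Defensive.
Import Order.TTheory GRing.Theory Num.Theory.
Local Open Scope ring_scope.

(** * Greedy composition of linear functions *)

Section Greedy.
Variables (R : realFieldType) (T : eqType) (a b c : T -> R).
Hypothesis a_ge0 : forall i, 0 <= a i.

Definition lin i x := a i * x + b i.
Definition trunc i x := Num.max (lin i x) (c i).
Definition improve i x := Num.max x (lin i x).

Definition slope_class i : nat :=
  if 0 < 1 - a i then 0 else if 1 - a i < 0 then 2 else 1.
Definition fixpoint i := b i / (1 - a i).
(* b / 0 = 0, so all translations (slope 1) have the same key; they commute. *)
Definition before i j :=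
  (slope_class i < slope_class j)%N
  || (slope_class i == slope_class j) && (fixpoint i <= fixpoint j).

Lemma before_trans : transitive before.
Proof.
move=> j i k /orP[ij|/andP[/eqP ij pij]] /orP[jk|/andP[/eqP jk pjk]]; rewrite /before.
- by rewrite (ltn_trans ij jk).
- by rewrite -jk ij.
- by rewrite ij jk.
- by rewrite ij jk eqxx (le_trans pij pjk) orbT.
Qed.

Lemma le_lin i : {homo lin i : x y / x <= y}.
Proof. by move=> x y xy; rewrite lerD2r ler_wpM2l. Qed.

Lemma le_trunc i : {homo trunc i : x y / x <= y}.
Proof. by move=> x y xy; rewrite ge_max !le_max lexx orbT le_lin. Qed.

Lemma le_improve i : {homo improve i : x y / x <= y}.
Proof. by move=> x y xy; rewrite ge_max !le_max xy le_lin ?orbT. Qed.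

Lemma improve_ge i x : x <= improve i x.
Proof. by rewrite le_max lexx. Qed.

Lemma le_lin_improve i x : lin i x <= improve i x.
Proof. by rewrite le_max lexx orbT. Qed.

(** Two steps in the wrong order never beat all of: dropping [j], dropping [i], swapping. If [lin j]
    does not raise [x], or [lin i] does not raise [lin j x], dropping that step suffices; otherwise
    the slope classes are compared. *)
Lemma lin_swap i j x : before i j ->
  [|| lin i (lin j x) <= lin i x, lin i (lin j x) <= lin j x
    | lin i (lin j x) <= lin j (lin i x)].
Proof.
have ai := a_ge0 i; have aj := a_ge0 j.
have lin_le y z : y <= z -> lin i y <= lin i z by apply: le_lin.
rewrite /before /slope_class /fixpoint.
case: (lerP (lin j x) x) => [/lin_le -> //|].
case: (lerP (lin i (lin j x)) (lin j x)) => [_ _ _|]; first by rewrite orbT.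
move=> hi hj H; apply/orP; right; apply/orP; right; move: hi hj H {lin_le}.
rewrite /lin.
move: (a i) (a j) (b i) (b j) ai aj => A B C D A0 B0.
case: (ltrgtP 0 (1 - A)) => hA; case: (ltrgtP 0 (1 - B)) => hB //=.
(* The difference of the two compositions is [C * (1 - B) - D * (1 - A)], free of [x]; its sign is
   the comparison of the fixed points with denominators cleared. *)
- rewrite ler_pdivrMr // mulrAC ler_pdivlMr // => H; lra.
(* a_i < 1 < a_j: the alternatives lin j x > x and lin i (lin j x) > lin j x
   already force lin j (lin i x) >= lin i (lin j x). *)
- move=> hi hj _.
  have h1 : 0 < (B * x + D) * (B - 1) + D by nra.
  have h2 : 0 < (1 - A) * ((B * x + D) * (B - 1) + D) by apply: mulr_gt0.
  nra.
- by have -> : B = 1 by [lra|]; nra.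
- rewrite ler_ndivrMr // mulrAC ler_ndivrMr // => H; lra.
- by have -> : A = 1 by [lra|]; nra.
- by have -> : A = 1 by [lra|]; have -> : B = 1 by [lra|]; lra.
Qed.

(** [improve] may skip a function at no loss, so each alternative of [lin_swap] is dominated by the
    sorted order. *)
Lemma improve_swap i j x : before i j ->
  improve i (improve j x) <= improve j (improve i x).
Proof.
move=> /(lin_swap x) ij.
have mono y : y <= improve i x -> lin j y <= improve j (improve i x).
  by move=> le_y; rewrite le_max le_lin ?orbT.
have le_id y : y <= improve i x -> y <= improve j (improve i x).
  by move=> le_y; rewrite le_max le_y.
have lin_i := le_lin_improve i x.
rewrite {1}/improve ge_max {1}/improve ge_max le_id ?improve_ge //=.
rewrite mono ?improve_ge //= /improve /Num.max.
case: ifP => _; last exact: le_id.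
by case/or3P: ij => /le_trans; apply; [exact: le_id|exact: mono (improve_ge _ _)|exact: mono].
Qed.

Definition greedy := foldl (fun x i => improve i x).

Lemma greedy_rcons x w i : greedy x (rcons w i) = improve i (greedy x w).
Proof. exact: foldl_rcons. Qed.

Lemma le_greedy w : {homo greedy^~ w : x y / x <= y}.
Proof. by elim: w => //= i w IH x y xy; apply/IH/le_improve. Qed.

(** Neighbour swaps carry [i] to the front. *)
Lemma greedy_move i w1 w2 x : all (before i) w1 ->
  greedy x (w1 ++ i :: w2) <= greedy (improve i x) (w1 ++ w2).
Proof.
elim: w1 x => //= j w1 IH x /andP[ij /IH w1_le].
exact: le_trans (w1_le _) (le_greedy _ (improve_swap _ ij)).
Qed.

(** Induction on [L]: its head is moved to the front of [w] if it occurs there, and otherwise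
    applying it first does no harm. *)
Lemma greedy_sorted w L x : pairwise before L -> uniq w -> {subset w <= L} ->
  greedy x w <= greedy x L.
Proof.
elim: L w x => [|i L IH] w x /=; first by case: w => //= j w _ _ /(_ j (mem_head _ _)).
move=> /andP[iL sL]; case: (boolP (i \in w)) => [/splitPr[w1 w2]|i_w] Uw sub.
  have Uiw : uniq (i :: w1 ++ w2) by rewrite -(perm_uniq (permEl (perm_catCA w1 [:: i] w2))).
  have sub' : {subset w1 ++ w2 <= L}.
    move=> j jw; have := sub j; rewrite mem_cat !inE orbCA -mem_cat jw orbT.
    by move=> /(_ isT)/predU1P[ji|//]; move: Uiw; rewrite /= -ji jw.
  apply: le_trans (IH _ _ sL _ sub'); last by case/andP: Uiw.
  apply: greedy_move; apply/allP => j jw; apply: (allP iL); apply: sub'.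
  by rewrite mem_cat jw.
apply: le_trans (IH _ _ sL Uw _) (le_greedy _ (improve_ge i x)) => j jw.
by have := sub j jw; rewrite inE => /predU1P[ji|//]; rewrite -ji jw in i_w.
Qed.

Definition trunc_comp := foldl (fun x i => trunc i x).

Lemma trunc_comp_rcons x w i : trunc_comp x (rcons w i) = trunc i (trunc_comp x w).
Proof. exact: foldl_rcons. Qed.

(* Cut the sequence after the last index at which the constant is the maximum. *)
Lemma trunc_comp_le x w :
  trunc_comp x w <= greedy x w \/
  exists s w2, subseq (s :: w2) w /\ trunc_comp x w <= greedy (c s) w2.
Proof.
elim/last_ind: w => [|w i IH]; first by left.
rewrite trunc_comp_rcons greedy_rcons.
have [ci|ci] := leP (lin i (trunc_comp x w)) (c i).
  have -> : trunc i (trunc_comp x w) = c i by apply: max_r.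
  by right; exists i, [::]; rewrite sub1seq mem_rcons mem_head.
have -> : trunc i (trunc_comp x w) = lin i (trunc_comp x w) by apply/max_l/ltW.
case: IH => [le_w|[s [w2 [sub le_w]]]]; [left|right].
  exact: le_trans (le_lin _ le_w) (le_lin_improve _ _).
exists s, (rcons w2 i); split.
  by rewrite -rcons_cons -!cats1 cat_subseq.
rewrite greedy_rcons.
exact: le_trans (le_lin _ le_w) (le_lin_improve _ _).
Qed.

End Greedy.

(** * Loop invariants of the sort and of the scan *)

Section Segments.
Variable T : Type.
Implicit Types (A : nat -> T) (v : T).

Lemma upd_same A j v : upd A j v j = v.
Proof. by rewrite /upd eqxx. Qed.

Lemma map_upd_notin A j v r : j \notin r -> map (upd A j v) r = map A r.
Proof.
move=> jr; apply/eq_in_map => k kr; rewrite /upd; case: eqP => // kj.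
by rewrite -kj kr in jr.
Qed.

Lemma map_iotaSr A i : map A (iota 0 i.+1) = rcons (map A (iota 0 i)) (A i).
Proof. by rewrite -addn1 iotaD map_cat cats1. Qed.

Lemma map_upd_rcons A i v :
  map (upd A i v) (iota 0 i.+1) = rcons (map A (iota 0 i)) v.
Proof. by rewrite map_iotaSr upd_same map_upd_notin // mem_iota ltnn. Qed.

Lemma map_upd_cat A i j v : (j < i)%N ->
  map (upd A j v) (iota 0 i) =
    map A (iota 0 j) ++ v :: map A (iota j.+1 (i - j.+1)).
Proof.
move=> ji; rewrite -[in LHS](subnKC ji) addSnnS iotaD add0n map_cat /=.
by rewrite upd_same !map_upd_notin // mem_iota ltnn.
Qed.

Lemma map_iota_cat A i j : (j < i)%N ->
  map A (iota 0 i) = map A (iota 0 j) ++ A j :: map A (iota j.+1 (i - j.+1)).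
Proof.
by move=> ji; rewrite -[in LHS](subnKC ji) addSnnS iotaD map_cat.
Qed.

End Segments.

(** * Array invariant of the insertion sort *)

Section Insertion.
Variable before : rel nat.
Hypothesis before_trans : transitive before.

(* Insertion sort of the indices: the element v carried along is swapped with
   every later one met in A, and is stored in A i at the end. *)
Definition inserting i j v (A : nat -> nat) :=
  [/\ perm_eq (v :: map A (iota 0 i)) (iota 0 i.+1),
      pairwise before (map A (iota 0 i)) &
      all (before^~ v) (map A (iota 0 j))].

Definition sorted_prefix i (A : nat -> nat) :=
  perm_eq (map A (iota 0 i)) (iota 0 i) /\ pairwise before (map A (iota 0 i)).

Lemma inserting_start i A : sorted_prefix i A -> inserting i 0 i A.
Proof.
case=> permA sA; split=> //.
by rewrite -addn1 iotaD cats1 perm_sym perm_rcons perm_cons perm_sym.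
Qed.

Lemma inserting_keep i j v A :
  before (A j) v -> inserting i j v A -> inserting i j.+1 v A.
Proof. by move=> Av [? ? allv]; split; rewrite // map_iotaSr all_rcons Av. Qed.

(** Entries left of cell [j] precede [v] by the invariant; those right of it follow [A j], hence [v]
    by transitivity. *)
Lemma inserting_swap i j v A : (j < i)%N ->
  before v (A j) -> inserting i j v A -> inserting i j.+1 (A j) (upd A j v).
Proof.
move=> ji vA []; rewrite /inserting map_upd_cat // map_upd_rcons (map_iota_cat _ ji).
move: (map _ _) (map _ _) => P S.
rewrite !pairwise_cat !pairwise_cons !allrel_consr => permA.
case/and3P=> /andP[PA PS] sP /andP[AS sS] Pv; split.
- apply: perm_trans permA; apply/seq.permP => p; rewrite /= !count_cat /=; lia.
- rewrite Pv PS sP sS /= andbT; apply/allP => x /(allP AS); exact: before_trans.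
- by rewrite all_rcons vA PA.
Qed.

Lemma inserting_end i v A :
  inserting i i v A -> sorted_prefix i.+1 (upd A i v).
Proof.
case=> permA sA allv; rewrite /sorted_prefix map_upd_rcons pairwise_rcons allv sA.
by rewrite perm_rcons.
Qed.

End Insertion.

(** * Array invariant of the scan for one starting value *)

Section Partition.
Variables (R : realFieldType) (a b c : nat -> R) (x0 : R) (n : nat).
Hypothesis a_ge0 : forall i, 0 <= a i.
Variables (A : nat -> nat) (s : nat).

(** A candidate [s < n] means that [s] is applied first and only its constant counts; [s = n]
    encodes the start from [x0]. *)
Definition start_value := if (s < n)%N then c s else x0.
Definition start_seq := if (s < n)%N then [:: s] else [::].
Definition others j := filter (predC1 s) (map A (iota 0 j)).
Definition value := greedy a b start_value (others n).

(* After j entries of A, the indices that were applied to x0 are in the cells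
   below k of O, and the discarded ones in the cells from m on. *)
Definition partitioning j k m (O : nat -> nat) x :=
  [/\ (k <= m <= n)%N,
      perm_eq (map O (iota 0 k) ++ map O (iota m (n - m))) (start_seq ++ others j),
      x = greedy a b start_value (others j) &
      x <= trunc_comp a b c x0 (map O (iota 0 k))].

Lemma othersS j :
  others j.+1 = if A j == s then others j else rcons (others j) (A j).
Proof. by rewrite /others map_iotaSr filter_rcons /=; case: eqP. Qed.

Lemma partitioning_start (O : nat -> nat) :
  partitioning 0 (s < n)%N n (if (s < n)%N then upd O 0 s else O)
    (if (s < n)%N then c s else x0).
Proof.
rewrite /partitioning /others /start_value /start_seq subnn leqnn andbT.
have [sn|sn] := ltnP s n; split => //; rewrite /= ?upd_same ?lexx //; first by lia.
by rewrite /trunc_comp /= le_max lexx orbT.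
Qed.

Lemma partitioning_skip j k m O x :
  A j = s -> partitioning j k m O x -> partitioning j.+1 k m O x.
Proof. by move=> Aj; rewrite /partitioning othersS Aj eqxx. Qed.

Hypothesis permA : perm_eq (map A (iota 0 n)) (iota 0 n).

Lemma uniq_start_others j : (j <= n)%N -> uniq (start_seq ++ others j).
Proof.
move=> jn; have Uo : uniq (others j).
  apply/filter_uniq/(@subseq_uniq _ _ (map A (iota 0 n))).
    by rewrite -(subnKC jn) iotaD map_cat prefix_subseq.
  by rewrite (perm_uniq permA) iota_uniq.
rewrite cat_uniq Uo andbT /start_seq; apply/andP; split; first by case: ifP.
by apply/hasPn => i; rewrite mem_filter => /andP[/= si _]; case: ifP; rewrite ?inE.
Qed.

Lemma start_others_lt j : (j <= n)%N -> {subset start_seq ++ others j <= iota 0 n}.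
Proof.
move=> jn i; rewrite mem_cat => /orP[|].
  by rewrite /start_seq; case: ifP => //= sn; rewrite inE mem_iota => /eqP->.
rewrite mem_filter => /andP[_ iA]; rewrite -(perm_mem permA) -(subnKC jn) iotaD map_cat.
by rewrite mem_cat iA.
Qed.

Lemma size_start_others j : (j <= n)%N -> (size (start_seq ++ others j) <= n)%N.
Proof.
move=> jn; rewrite -[leqRHS](size_iota 0).
exact: uniq_leq_size (uniq_start_others jn) (start_others_lt jn).
Qed.

Lemma perm_start_others : perm_eq (start_seq ++ others n) (iota 0 n).
Proof.
apply: uniq_perm; rewrite ?iota_uniq ?uniq_start_others // => i.
apply/idP/idP; first exact: start_others_lt.
rewrite mem_cat mem_filter (perm_mem permA) /= => iN; rewrite iN andbT.
case: eqP => [is_|]; last by rewrite orbT.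
by move: iN; rewrite mem_iota /start_seq is_ add0n => /= ->; rewrite mem_head.
Qed.

(** Counting: the occupied cells hold distinct indices below [n], and [A j] is a further one. Hence
    the blocks growing from both ends of [O] do not collide. *)
Lemma partitioning_room j k m O x : (j < n)%N -> A j <> s ->
  partitioning j k m O x -> (k < m)%N.
Proof.
move=> jn /eqP/negPf Aj [km /perm_size sz _ _].
have := size_start_others jn; rewrite othersS Aj; move: sz.
rewrite !size_cat size_rcons !size_map !size_iota.
move: (size start_seq) (size (others j)) => p q; lia.
Qed.

Lemma partitioning_front j k m O x : (j < n)%N -> A j <> s ->
  x < lin a b (A j) x -> partitioning j k m O x ->
  partitioning j.+1 k.+1 m (upd O k (A j)) (lin a b (A j) x).
Proof.
move=> jn Aj xlt part; have km := partitioning_room jn Aj part.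
case: part => kmn permO xE xle; move/eqP/negPf: Aj => Aj.
have imp : lin a b (A j) x = improve a b (A j) x by rewrite /improve max_r // ltW.
rewrite /partitioning othersS Aj map_upd_rcons map_upd_notin ?mem_iota; last by lia.
split; first by lia.
- apply: perm_trans (_ : perm_eq _ (A j :: map O (iota 0 k) ++ map O (iota m (n - m)))) _.
    by rewrite -cat_cons perm_cat2r perm_rcons.
  by rewrite -rcons_cat perm_sym perm_rcons perm_cons perm_sym.
- by rewrite greedy_rcons imp xE.
(* The scan ignores the constants, so it only underestimates the true composition. *)
- rewrite trunc_comp_rcons; apply: le_trans (le_trunc b c a_ge0 (A j) xle).
  by rewrite le_max lexx.
Qed.

Lemma partitioning_back j k m O x : (j < n)%N -> A j <> s ->
  lin a b (A j) x <= x -> partitioning j k m O x ->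
  partitioning j.+1 k m.-1 (upd O m.-1 (A j)) x.
Proof.
move=> jn Aj xlt part; have km := partitioning_room jn Aj part.
case: part => kmn permO xE xle; move/eqP/negPf: Aj => Aj.
have -> : partitioning j.+1 k m.-1 (upd O m.-1 (A j)) x <->
  [/\ (k <= m.-1 <= n)%N,
      perm_eq (map O (iota 0 k) ++ A j :: map O (iota m (n - m)))
              (start_seq ++ rcons (others j) (A j)),
      x = greedy a b start_value (rcons (others j) (A j)) &
      x <= trunc_comp a b c x0 (map O (iota 0 k))].
  rewrite /partitioning othersS Aj map_upd_notin ?mem_iota; last by lia.
  have -> : (n - m.-1 = (n - m).+1)%N by lia.
  by rewrite /= upd_same prednK ?map_upd_notin ?mem_iota //; lia.
split=> //; first by lia.
- rewrite -rcons_cat perm_sym perm_rcons perm_sym.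
  rewrite -(perm_cat2l [:: A j]) /= in permO; apply: perm_trans permO.
  by rewrite -cat_cons -cat1s perm_catCA.
- by rewrite greedy_rcons -xE /improve max_l.
Qed.

Lemma partitioning_end k m O x : partitioning n k m O x ->
  [/\ (k <= n)%N, perm_eq (map O (iota 0 n)) (iota 0 n), x = value &
      x <= trunc_comp a b c x0 (map O (iota 0 k))].
Proof.
case=> kmn permO xE xle; split=> //; first by lia.
have permO' := perm_trans permO perm_start_others.
(* All [n] indices are placed, so the two blocks meet and [O] lists a permutation. *)
have km : k = m.
  by have := perm_size permO'; rewrite size_cat !size_map !size_iota; lia.
rewrite -km -map_cat -[k in iota k _]add0n -iotaD subnKC // in permO'; lia.
Qed.

End Partition.

Lemma trunc_comp_le_value (R : realFieldType) (a b c : nat -> R) x0 n A w :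
  (forall i, 0 <= a i) ->
  perm_eq (map A (iota 0 n)) (iota 0 n) ->
  pairwise (before a b) (map A (iota 0 n)) ->
  uniq w -> {subset w <= iota 0 n} ->
  exists2 s, (s <= n)%N & trunc_comp a b c x0 w <= value a b c x0 n A s.
Proof.
move=> a_ge0 permA sA Uw sub.
case: (trunc_comp_le b c a_ge0 x0 w) => [|[s [w2 [sub_w2]]]] /le_trans le_w.
  exists n => //; apply: le_w; rewrite /value /start_value ltnn; apply: greedy_sorted => //.
    exact: pairwise_filter.
  move=> i /sub iw; rewrite mem_filter (perm_mem permA) iw /=.
  by move: iw; rewrite mem_iota; lia.
have sw : s \in w by rewrite (mem_subseq sub_w2) ?mem_head.
have sn : (s < n)%N by have := sub _ sw; rewrite mem_iota.
exists s; first exact: ltnW.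
apply: le_w; rewrite /value /start_value sn.
have /= /andP[s_w2 Uw2] := subseq_uniq sub_w2 Uw.
apply: greedy_sorted => //; first exact: pairwise_filter.
move=> i iw2; rewrite mem_filter (perm_mem permA) sub ?andbT /=; last first.
  by rewrite (mem_subseq sub_w2) // inE iw2 orbT.
(* Since [w] has no repetition, [s] does not recur after the cut, so the tail lies in [others]. *)
by apply: contraNneq s_w2 => <-.
Qed.

(** * Total correctness with running time *)

Notation "p ;; q" := (Seq p q) (at level 60, right associativity).

Fixpoint written (w : instr -> seq nat) (p : prog) : seq nat :=
  match p with
  | Skip => [::]
  | Do i => w i
  | Seq p q | If _ p q => written w p ++ written w q
  | While _ p => written w p
  end.

Definition nregs i :=
  match i with NConst x _ | NAdd x _ _ | NSub x _ _ | NLoad x _ _ => [:: x] | _ => [::] end.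
Definition narrs i := if i is NStore A _ _ then [:: A] else [::].
Definition rregs i :=
  match i with RConst x _ | RArith _ x _ _ | RLoad x _ _ => [:: x] | _ => [::] end.
Definition rarrs i := if i is RStore A _ _ then [:: A] else [::].

Fixpoint cost (p : prog) : nat :=
  match p with
  | Skip | Do _ => 1
  | Seq p q => cost p + cost q
  | If _ p q => (maxn (cost p) (cost q)).+1
  | While _ _ => 0
  end.

Section Logic.
Variable R : realType.
Implicit Types (s : state R) (Q : state R -> Prop) (p q : prog).

Definition frame p s s' :=
  [/\ forall x, x \notin written nregs p -> nreg s' x = nreg s x,
      forall x, x \notin written narrs p -> narr s' x = narr s x,
      forall x, x \notin written rregs p -> rreg s' x = rreg s x &
      forall x, x \notin written rarrs p -> rarr s' x = rarr s x].

Lemma exec_frame p s t s' : exec p s t s' -> frame p s s'.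
Proof.
have sub p1 p2 s1 s2 : frame p1 s1 s2 ->
    (forall w, {subset written w p1 <= written w p2}) -> frame p2 s1 s2.
  case=> h1 h2 h3 h4 sub; split=> x xp; [apply: h1|apply: h2|apply: h3|apply: h4];
    by apply: contra xp; apply: sub.
have trans p1 s1 s2 s3 : frame p1 s1 s2 -> frame p1 s2 s3 -> frame p1 s1 s3.
  case=> h1 h2 h3 h4 [k1 k2 k3 k4].
  by split=> x xp; rewrite ?k1 ?k2 ?k3 ?k4 ?h1 ?h2 ?h3 ?h4.
elim=> {p s t s'} //.
- case=> [x m|x y z|x y z|x A y|A y x|x m|o x y z|x A y|A y x] s; split=> z' //=;
    rewrite inE => /negPf zx; by rewrite /upd2 /upd zx.
- move=> p q s1 s2 s3 t u _ h1 _ h2; apply: (trans _ _ s2).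
    by apply: sub h1 _ => w x xp; rewrite /= mem_cat xp.
  by apply: sub h2 _ => w x xp; rewrite /= mem_cat xp orbT.
- move=> b p q s t s' _ _ h; apply: sub h _ => w x xp.
  by rewrite /= mem_cat xp.
- move=> b p q s t s' _ _ h; apply: sub h _ => w x xp.
  by rewrite /= mem_cat xp orbT.
- by move=> b p s1 s2 s3 t u _ _ h1 _ h2; apply: trans h1 h2.
Qed.

Definition runs p s (T : nat) Q :=
  exists t s', [/\ exec p s t s', (t <= T)%N & Q s'].

Lemma runs_frame p s T Q :
  runs p s T Q -> runs p s T (fun s' => Q s' /\ frame p s s').
Proof.
by move=> [t [s' [ex tT Qs]]]; exists t, s'; split=> //; split=> //; exact: exec_frame ex.
Qed.

Lemma runs_weaken p s T T' Q Q' : (T <= T')%N -> (forall s', Q s' -> Q' s') ->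
  runs p s T Q -> runs p s T' Q'.
Proof.
move=> TT QQ [t [s' [ex tT Qs]]]; exists t, s'.
by split; [|exact: leq_trans TT|exact: QQ].
Qed.

Lemma runs_seq p q s T U Q :
  runs p s T (fun s' => runs q s' U Q) -> runs (p ;; q) s (T + U) Q.
Proof.
move=> [t [s1 [ex1 tT [u [s2 [ex2 uU Qs]]]]]]; exists (t + u)%N, s2.
by split; [exact: exec_Seq ex1 ex2|exact: leq_add|].
Qed.

(* Weakest precondition of loop-free programs only, like cost; loops are handled
   by runs_for. *)
Fixpoint wp p s Q : Prop :=
  match p with
  | Skip => Q s
  | Do i => Q (instr_sem i s)
  | Seq p q => wp p s (fun s' => wp q s' Q)
  | If b p q => if test_sem b s then wp p s Q else wp q s Q
  | While _ _ => False
  end.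

Lemma wp_runs p s Q : wp p s Q -> runs p s (cost p) Q.
Proof.
elim: p s Q => [|i|p IHp q IHq|b p IHp q IHq|//] s Q /=.
- by exists 1%N, s; split=> //; exact: exec_Skip.
- by exists 1%N, (instr_sem i s); split=> //; exact: exec_Do.
- move/IHp=> h; apply: runs_seq; apply: runs_weaken h => // s'; exact: IHq.
- case: ifP => bs => [/IHp|/IHq] [t [s' [ex tT Qs]]]; exists t.+1, s'; split=> //.
  + exact: exec_IfT.
  + by rewrite ltnS leq_max tT.
  + by apply: exec_IfF; rewrite ?bs.
  + by rewrite ltnS leq_max tT orbT.
Qed.

(* Register 3 holds 1 throughout. *)
Definition For i lim p := While (NLt i lim) (p ;; Do (NAdd i i 3)).

(** Each round costs [T] plus one test and one increment; the final 1 is the failing test.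
    [Inv j.+1] is required after the increment, hence the [set_nreg]. *)
Lemma runs_for i lim p m T (Inv : nat -> state R -> Prop) s j :
  [&& i != lim, i != 3 & all [predC written nregs p] [:: i; lim; 3]] ->
  nreg s i = j -> nreg s lim = m -> nreg s 3 = 1%N -> (j <= m)%N -> Inv j s ->
  (forall j s, (j < m)%N -> nreg s i = j -> nreg s lim = m -> nreg s 3 = 1%N ->
     Inv j s -> runs p s T (fun s' => Inv j.+1 (set_nreg s' i j.+1))) ->
  runs (For i lim p) s ((m - j) * (T + 2) + 1) (Inv m).
Proof.
case/and3P=> ilim i3 /and4P[/= pi plim p3 _] si slim s3 jm invs body.
elim: {j}(m - j)%N {-2}j (erefl (m - j)%N) s si slim s3 jm invs
  => [|d IH] j dE s si slim s3 jm invs.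
  exists 1%N, s; split; [|by rewrite addn1|by have <- : j = m by lia].
  by apply: exec_WhileF; rewrite /= si slim; lia.
have jltm : (j < m)%N by lia.
have [t [s1 [ex1 tT [inv1 [fr _ _ _]]]]] := runs_frame (body j s jltm si slim s3 invs).
pose s2 := set_nreg s1 i j.+1.
have ex2 : exec (Do (NAdd i i 3)) s1 1 s2.
  have -> : s2 = instr_sem (NAdd i i 3) s1 by rewrite /= !fr // si s3 addn1.
  exact: exec_Do.
have [||||u [s3' [ex3 uU invm]]] := IH j.+1 _ s2 _ _ _ jltm inv1.
- lia.
- by rewrite /= /upd eqxx.
- by rewrite /= /upd eq_sym (negPf ilim) fr.
- by rewrite /= /upd eq_sym (negPf i3) fr.
exists (t + 1 + u).+1, s3'; split=> //.
  by apply: exec_WhileT ex3; [rewrite /= si slim|exact: exec_Seq ex1 ex2].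
have -> : (m - j = (m - j.+1).+1)%N by lia.
by rewrite mulSn; lia.
Qed.

End Logic.

(** * The program *)

(* Index registers: 0 k, 1 n, 2 zero, 3 one, 4 current candidate start, 5 best
   candidate (n stands for x0), 6 and 7 loop counters, 8 and 9 indices of
   functions, 10 and 11 slope classes, 12 lower end of the discarded block.
   Index arrays: 0 output, 1 sorted indices.
   Real registers: 0 x0, 1 zero, 2 current value, 3 best value. *)
Definition put_key i cl p :=
  Do (RLoad 5 0 i) ;; Do (RLoad 6 1 i) ;; Do (RConst 9 1) ;;
  Do (RArith Defs.Sub 9 9 5) ;; Do (RArith Div p 6 9) ;;
  If (RLt 1 9) (Do (NConst cl 0))
    (If (RLt 9 1) (Do (NConst cl 2)) (Do (NConst cl 1))).

(** Adding index register 2 or real register 1, both zero, serves as a copy instruction. *)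
Definition swap_carry := Do (NStore 1 7 8) ;; Do (NAdd 8 9 2).

Definition insert_step :=
  Do (NLoad 9 1 7) ;; put_key 8 10 7 ;; put_key 9 11 8 ;;
  If (NLt 10 11) swap_carry
    (If (NLt 11 10) Skip (If (RLt 7 8) swap_carry Skip)).

Definition insert_prog :=
  Do (NAdd 8 6 2) ;; Do (NConst 7 0) ;; For 7 6 insert_step ;; Do (NStore 1 6 8).

Definition sort_prog := Do (NConst 6 0) ;; For 6 1 insert_prog.

Definition apply_step :=
  Do (RLoad 5 0 8) ;; Do (RLoad 6 1 8) ;;
  Do (RArith Mul 7 5 2) ;; Do (RArith Add 7 7 6) ;;
  If (RLt 2 7)
    (Do (RArith Add 2 7 1) ;; Do (NStore 0 0 8) ;; Do (NAdd 0 0 3))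
    (Do (NSub 12 12 3) ;; Do (NStore 0 12 8)).

(** The two strict tests together express that the index differs from the candidate, which must not
    be used twice. *)
Definition eval_step :=
  Do (NLoad 8 1 7) ;; If (NLt 8 4) apply_step (If (NLt 4 8) apply_step Skip).

Definition eval_init :=
  Do (NConst 0 0) ;; Do (NAdd 12 1 2) ;; Do (RArith Add 2 0 1) ;;
  If (NLt 4 1) (Do (RLoad 2 2 4) ;; Do (NStore 0 0 4) ;; Do (NAdd 0 0 3)) Skip ;;
  Do (NConst 7 0).

Definition eval_prog := eval_init ;; For 7 1 eval_step.

Definition keep_best :=
  If (RLt 3 2) (Do (RArith Add 3 2 1) ;; Do (NAdd 5 4 2)) Skip.

(** The first copy frees register 0 for [k]. Each scan overwrites the output, so the best candidate
    is evaluated once more at the end. *)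
Definition best_prog :=
  Do (NAdd 1 0 2) ;; Do (NConst 3 1) ;; sort_prog ;;
  (Do (NAdd 4 1 2) ;; eval_prog ;; Do (RArith Add 3 2 1) ;; Do (NAdd 5 4 2)) ;;
  (Do (NConst 4 0) ;; For 4 1 (eval_prog ;; keep_best)) ;;
  Do (NAdd 4 5 2) ;; eval_prog.

(** * Correctness and running time of the program *)

Section Correctness.
Variables (R : realType) (a b c : nat -> R) (x0 : R) (n : nat).
Hypothesis a_ge0 : forall i, 0 <= a i.
Implicit Types s : state R.

Definition env s :=
  [/\ nreg s 1 = n, nreg s 2 = 0%N & nreg s 3 = 1%N] /\
  [/\ rreg s 0 = x0, rreg s 1 = 0, rarr s 0 = a, rarr s 1 = b & rarr s 2 = c].

Lemma env_frame p s s' :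
  ~~ has [in written nregs p] [:: 1; 2; 3] -> ~~ has [in written rregs p] [:: 0; 1] ->
  ~~ has [in written rarrs p] [:: 0; 1; 2] ->
  frame p s s' -> env s -> env s'.
Proof.
rewrite -!all_predC => /and4P[n1 n2 n3 _] /and3P[r1 r2 _] /and4P[a1 a2 a3 _].
by move=> [fn _ fr fa] [[? ? ?] [? ? ? ? ?]]; split; split; rewrite ?fn ?fr ?fa.
Qed.

Lemma insert_step_runs s i j : (j < i)%N -> env s ->
  nreg s 7 = j -> inserting (before a b) i j (nreg s 8) (narr s 1) ->
  runs insert_step s (cost insert_step)
    (fun s' => inserting (before a b) i j.+1 (nreg s' 8) (narr s' 1)).
Proof.
move=> ji [[_ s2 _] [_ r1 A0 A1 _]] s7 ins; apply: wp_runs.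
rewrite /= /upd /= s2 s7 r1 A0 A1 addn0.
set v := nreg s 8 in ins *; set u := narr s 1 j.
have swap : before a b v u -> inserting (before a b) i j.+1 u (upd2 (narr s) 1 j v 1).
  by move=> vu; apply: inserting_swap ins => //; exact: before_trans.
have keep : before a b u v -> inserting (before a b) i j.+1 v (narr s 1).
  by move=> uv; apply: inserting_keep.
move: swap keep; rewrite /before /slope_class /fixpoint.
case: (ltP (b v / (1 - a v))) => [/ltW|] H;
  by case: (ltrgtP 0 (1 - a v)) => _; case: (ltrgtP 0 (1 - a u)) => _ /= sw kp; auto.
Qed.

Lemma insert_runs s i : env s -> nreg s 6 = i ->
  sorted_prefix (before a b) i (narr s 1) ->
  runs insert_prog s (i * (cost insert_step + 2) + 4)
    (fun s' => sorted_prefix (before a b) i.+1 (narr s' 1)).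
Proof.
move=> env_s s6 sorted_i; have [[s1 s2 s3] _] := env_s.
apply: (@runs_weaken _ _ _ (1 + (1 + (((i - 0) * (cost insert_step + 2) + 1) + 1))) _
  _ _ _ (fun _ => id)); first by lia.
apply/runs_seq/wp_runs/runs_seq/wp_runs/runs_seq; set s0 := instr_sem _ _.
pose Inv j s' := [/\ env s', nreg s' 6 = i &
  inserting (before a b) i j (nreg s' 8) (narr s' 1)].
have := @runs_for _ 7 6 insert_step i (cost insert_step) Inv s0 0.
move/(_ isT erefl s6 s3 (leq0n i)) => h; apply: runs_weaken (h _ _) => //.
- move=> s' [env' s'6 ins]; apply: wp_runs.
  rewrite /= /sorted_prefix s'6; exact: inserting_end.
- split=> //; rewrite /s0 /= /upd /= s6 s2 addn0; exact: inserting_start.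
- move=> j s' ji s'7 s'lim s'3 [env' s'6 ins].
  apply: runs_weaken (runs_frame (insert_step_runs ji env' s'7 ins)) => // s'' [ins' fr].
  split=> //; first exact: env_frame fr env'.
  by case: fr => fr _ _ _; rewrite /= /upd /= fr.
Qed.

Lemma sort_runs s : env s ->
  runs sort_prog s (n * (n * (cost insert_step + 2) + 6) + 2)
    (fun s' => sorted_prefix (before a b) n (narr s' 1)).
Proof.
move=> env_s; have [[s1 s2 s3] _] := env_s.
apply: (@runs_weaken _ _ _
  (1 + ((n - 0) * (n * (cost insert_step + 2) + 4 + 2) + 1)) _ _ _ _ (fun _ => id)).
  by lia.
apply/runs_seq/wp_runs; pose s0 := instr_sem (NConst 6 0) s.
pose Inv i s' := env s' /\ sorted_prefix (before a b) i (narr s' 1).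
have := @runs_for _ 6 1 insert_prog n (n * (cost insert_step + 2) + 4) Inv s0 0.
move/(_ isT erefl s1 s3 (leq0n n)) => h; apply: runs_weaken (h _ _) => //.
- by move=> s' [].
- move=> i s' lt_in s'6 s'lim s'3 [env' sorted_i].
  have := runs_frame (insert_runs env' s'6 sorted_i).
  apply: runs_weaken => [|s'' [sorted' fr]].
    by rewrite leq_add2r leq_mul2r ltnW ?orbT.
  by split=> //; exact: env_frame fr env'.
Qed.

Section Evaluation.
Variables (A : nat -> nat) (cand : nat).
Hypothesis permA : perm_eq (map A (iota 0 n)) (iota 0 n).
Hypothesis cand_le : (cand <= n)%N.

Definition evaluating j s :=
  [/\ env s, nreg s 4 = cand, narr s 1 = A &
      partitioning a b c x0 n A cand j (nreg s 0) (nreg s 12) (narr s 0) (rreg s 2)].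

Lemma apply_step_wp s j : (j < n)%N -> A j <> cand -> nreg s 8 = A j ->
  evaluating j s -> wp apply_step s (evaluating j.+1).
Proof.
move=> jn Aj s8 [env_s s4 s1 part]; have [[_ _ s3] [_ r1 A0 A1 _]] := env_s.
rewrite /= /upd /= A0 A1 s8 r1 s3 addr0; case: ltP => [lt_x|le_x]; split=> //.
- rewrite /= /upd /= addn1; exact: partitioning_front.
- rewrite /= /upd /= subn1; exact: partitioning_back.
Qed.

Lemma eval_step_runs s j : (j < n)%N -> nreg s 7 = j -> evaluating j s ->
  runs eval_step s (cost eval_step)
    (fun s' => evaluating j.+1 (set_nreg s' 7 j.+1)).
Proof.
move=> jn s7 ev.
(* [evaluating] does not read the loop counter, so its update can be ignored. *)
suff : runs eval_step s (cost eval_step) (evaluating j.+1).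
  by apply: runs_weaken.
apply: wp_runs; have [env_s s4 s1 part] := ev.
have ev8 : evaluating j (set_nreg s 8 (A j)) by [].
have ap : A j <> cand -> wp apply_step (set_nreg s 8 (A j)) (evaluating j.+1).
  by move=> Aj; apply: apply_step_wp ev8.
rewrite /eval_step; set q := apply_step in ap *.
rewrite /= s7 s1 /upd /= s4; case: ltngtP => // Aj.
- by apply: ap => Ajc; rewrite Ajc ltnn in Aj.
- by apply: ap => Ajc; rewrite Ajc ltnn in Aj.
- by have [? ? ?] := ev8; split=> //; apply: partitioning_skip.
Qed.

Definition eval_cost := (n * (cost eval_step + 2) + cost eval_init + 1)%N.

Lemma eval_runs s : env s -> nreg s 4 = cand -> narr s 1 = A ->
  runs eval_prog s eval_cost
    (fun s' => rreg s' 2 = value a b c x0 n A cand /\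
      [/\ (nreg s' 0 <= n)%N, perm_eq (map (narr s' 0) (iota 0 n)) (iota 0 n) &
          value a b c x0 n A cand <=
            trunc_comp a b c x0 (map (narr s' 0) (iota 0 (nreg s' 0)))]).
Proof.
move=> env_s s4 s1A; have [[s1 s2 s3] [r0 r1 A0 A1 A2]] := env_s.
apply: (@runs_weaken _ _ _ (cost eval_init + ((n - 0) * (cost eval_step + 2) + 1)) _
  _ _ _ (fun _ => id)); first by rewrite /eval_cost; lia.
apply: runs_seq.
have init : runs eval_init s (cost eval_init)
    (fun s' => evaluating 0 s' /\ nreg s' 7 = 0%N).
  apply: wp_runs; have := partitioning_start a b c x0 n A cand (narr s 0).
  rewrite /= /upd /= s4 s1 s2 s3 r0 r1 A2 addn0 addr0; case: ltnP => _ part.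
  - by split.
  - by split.
apply: runs_weaken init => // s' [ev s'7]; have [env' s'4 s'1A part] := ev.
have [[s'1 _ s'3] _] := env'.
have := @runs_for _ 7 1 eval_step n (cost eval_step) evaluating s' 0.
move/(_ isT s'7 s'1 s'3 (leq0n n) ev) => h; apply: runs_weaken (h _) => //.
- move=> s2' [_ _ _ /(partitioning_end permA) [kn permO xE le_x]].
  by rewrite -xE.
- by move=> j s2' jn s2'7 _ _; apply: eval_step_runs.
Qed.

End Evaluation.

Definition best_cost :=
  (2 + (n * (n * (cost insert_step + 2) + 6) + 2) + (eval_cost + 3)
   + (1 + (n * (eval_cost + cost keep_best + 2) + 1)) + 1 + eval_cost)%N.

Section Search.
Variable A : nat -> nat.
Hypothesis permA : perm_eq (map A (iota 0 n)) (iota 0 n).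
Let V := value a b c x0 n A.

(** Candidate [n] is evaluated before the loop, hence its separate clause. *)
Definition best_upto cand s :=
  [/\ env s, narr s 1 = A & [/\ (nreg s 5 <= n)%N, rreg s 3 = V (nreg s 5),
      V n <= rreg s 3 & forall i, (i < cand)%N -> V i <= rreg s 3]].

Lemma eval_keeps s s' : frame eval_prog s s' ->
  [/\ env s -> env s', nreg s' 4 = nreg s 4, nreg s' 5 = nreg s 5,
      narr s' 1 = narr s 1 & rreg s' 3 = rreg s 3].
Proof.
move=> fr; split; first exact: env_frame fr.
all: by case: fr => fn fA fr _; rewrite ?fn ?fA ?fr.
Qed.

Lemma search_start s : env s -> narr s 1 = A ->
  runs (Do (NAdd 4 1 2) ;; eval_prog ;; Do (RArith Add 3 2 1) ;; Do (NAdd 5 4 2)) s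
    (eval_cost + 3) (best_upto 0).
Proof.
move=> env_s s1A; have [[s1 s2 s3] _] := env_s.
apply: (@runs_weaken _ _ _ (1 + (eval_cost + 2)) _ _ _ _ (fun _ => id)).
  by lia.
apply/runs_seq/wp_runs; pose s' := instr_sem (NAdd 4 1 2) s.
have s'4 : nreg s' 4 = n by rewrite /= /upd /= s1 s2 addn0.
apply: runs_seq.
have := runs_frame (eval_runs permA (leqnn n) (s := s') env_s s'4 s1A).
apply: runs_weaken => // s2' [[xE _]].
move=> /eval_keeps[/(_ env_s) env' s2'4 _ s2'1 _]; apply: wp_runs.
have [[_ z2 _] [_ z1 _ _ _]] := env'.
rewrite /= /best_upto /= /upd /= xE s2'4 s'4 z2 z1 addn0 addr0.
by split=> //; rewrite s2'1.
Qed.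

Lemma search_step s i : (i < n)%N -> nreg s 4 = i -> best_upto i s ->
  runs (eval_prog ;; keep_best) s (eval_cost + cost keep_best)
    (fun s' => best_upto i.+1 (set_nreg s' 4 i.+1)).
Proof.
move=> lt_in s4 [env_s s1A [bc_le bestE n_le le_best]]; apply: runs_seq.
apply: runs_weaken (runs_frame (eval_runs permA (ltnW lt_in) env_s s4 s1A)) => // s' [[xE _]].
move=> /eval_keeps[/(_ env_s) env' s'4 s'5 s'1 s'3]; apply: wp_runs.
have [[_ z2 _] [_ z1 _ _ _]] := env'.
rewrite /= /best_upto /= /upd /= xE s'3 s'4 s'5 z1 z2 s4 addn0 addr0 s'1.
case: ltP => [better|worse]; split=> //; split=> //.
- exact: ltnW.
- exact: le_trans n_le (ltW better).
- move=> l; rewrite ltnS leq_eqVlt => /predU1P[-> //|/le_best le_l].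
  exact: le_trans le_l (ltW better).
- by move=> l; rewrite ltnS leq_eqVlt => /predU1P[-> //|/le_best].
Qed.

End Search.

(** Prefixes of permutations are exactly the duplicate-free sequences of indices. *)
Definition optimal_output s :=
  [/\ (nreg s 0 <= n)%N, perm_eq (map (narr s 0) (iota 0 n)) (iota 0 n) &
      forall w, uniq w -> {subset w <= iota 0 n} ->
        trunc_comp a b c x0 w <=
        trunc_comp a b c x0 (map (narr s 0) (iota 0 (nreg s 0)))].

Lemma best_runs s : env (instr_sem (NConst 3 1) (instr_sem (NAdd 1 0 2) s)) ->
  runs best_prog s best_cost optimal_output.
Proof.
move=> env0.
apply: (@runs_weaken _ _ _
  (1 + (1 + ((n * (n * (cost insert_step + 2) + 6) + 2) + ((eval_cost + 3)
   + ((1 + ((n - 0) * (eval_cost + cost keep_best + 2) + 1)) + (1 + eval_cost))))))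
  _ _ _ _ (fun _ => id)); first by rewrite /best_cost; lia.
apply/runs_seq/wp_runs/runs_seq/wp_runs/runs_seq.
apply: runs_weaken (runs_frame (sort_runs env0)) => // s1 [[permA sA] fr1].
have {fr1} env1 : env s1 by apply: env_frame fr1 env0.
apply: runs_seq; apply: runs_weaken (search_start permA env1 erefl) => // s2 best2.
apply/runs_seq/runs_seq/wp_runs; pose s2' := instr_sem (NConst 4 0) s2.
have {}best2 : best_upto (narr s1 1) 0 s2' := best2.
have [[[s2'1 _ s2'3] _] _ _] := best2.
have := @runs_for _ 4 1 (eval_prog ;; keep_best) n _ (best_upto (narr s1 1)) s2' 0.
move/(_ _ isT erefl s2'1 s2'3 (leq0n n) best2) => h.
apply: runs_weaken (h _ _) => // {h} [s3|i s' lt_in s'4 _ _]; last exact: search_step.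
case=> env3 s3A [bc_le bestE n_le le_best]; have [[_ s32 _] _] := env3.
apply/runs_seq/wp_runs; pose s3' := instr_sem (NAdd 4 5 2) s3.
have s3'4 : nreg s3' 4 = nreg s3 5 by rewrite /= /upd /= s32 addn0.
apply: runs_weaken (eval_runs permA bc_le (s := s3') env3 s3'4 s3A) => // s4.
case=> _ [kn permO le_out]; split=> // w Uw sub_w.
(* Sandwich: the composition along [w] is at most some candidate value, hence at most the best one,
   which the true composition of the output attains or exceeds. *)
have [i le_in le_w] := trunc_comp_le_value c x0 a_ge0 permA sA Uw sub_w.
apply: le_trans le_w (le_trans _ le_out); rewrite -bestE.
by move: le_in; rewrite leq_eqVlt => /predU1P[-> //|/le_best].
Qed.

End Correctness.

(** * Quadratic bound and return to permutations *)

Lemma best_cost_le n : (0 < n)%N -> (best_cost n <= 500 * n ^ 2)%N.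
Proof.
(* The cost is [37 * n ^ 2 + 46 * n + 28]; 500 is a generous constant. *)
move=> n_gt0; rewrite /best_cost /eval_cost /=; nia.
Qed.

Lemma perm_of_seq n (O : seq nat) : perm_eq O (iota 0 n) ->
  exists sigma : {perm 'I_n}, O = [seq val (sigma i) | i <- enum 'I_n].
Proof.
move=> permO; have sizeO : size O = n by rewrite (perm_size permO) size_iota.
have O_lt i : (i < n)%N -> (nth 0%N O i < n)%N.
  rewrite -{1}sizeO => /(mem_nth 0%N).
  by rewrite (perm_mem permO) mem_iota.
pose f (i : 'I_n) := Ordinal (O_lt i (ltn_ord i)).
have f_inj : injective f.
  move=> i j /(congr1 val) /= /eqP; rewrite nth_uniq ?sizeO //; first by move/eqP/val_inj.
  by rewrite (perm_uniq permO) iota_uniq.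
exists (perm f_inj); apply: (@eq_from_nth _ 0%N) => [|i].
  by rewrite size_map size_enum_ord.
rewrite sizeO => lt_in; rewrite (nth_map (Ordinal lt_in)) ?size_enum_ord // permE /=.
by rewrite nth_enum_ord.
Qed.

Theorem theorem4 (R : realType) :
  exists (p : prog) (K : nat),
    forall (n : nat) (a b c : 'I_n -> R) (x0 : R),
      (forall i, 0 <= a i) ->
      exists (t : nat) (s : state R) (sigma : {perm 'I_n}) (k : nat),
        [/\ exec p (input a b c x0) t s,
            (0 < n)%N -> (t <= K * n ^ 2)%N,
            outputs s sigma k &
            max_partial_composition
              (fun i x => Num.max (a i * x + b i) (c i)) x0 sigma k].
Proof.
exists best_prog, 500%N => n a b c x0 a_ge0.
have cellsE (v : 'I_n -> R) (i : 'I_n) : cells v i = v i by rewrite /cells valK.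
(* The padding value 0 keeps the slopes nonnegative at every natural index. *)
have cells_ge0 i : 0 <= cells a i by rewrite /cells; case: insubP => /=.
have := @best_runs R (cells a) (cells b) (cells c) x0 n cells_ge0 (input a b c x0).
case=> [|t [s [ex t_le [k_le permO opt]]]].
  by split; split; rewrite //= /upd /= addn0.
have [sigma OE] := perm_of_seq permO.
exists t, s, sigma, (nreg s 0); split=> //.
- by move=> n_gt0; apply: leq_trans t_le (best_cost_le n_gt0).
- split=> // i; have := congr1 (nth 0%N ^~ i) OE.
  by rewrite /= (nth_map 0%N) ?size_iota // nth_iota // (nth_map i) ?size_enum_ord // nth_ord_enum.
have compE (tau : {perm 'I_n}) l :
    partial_composition (fun i x => Num.max (a i * x + b i) (c i)) x0 tau l =
    trunc_comp (cells a) (cells b) (cells c) x0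
      (map val (take l [seq tau i | i <- enum 'I_n])).
  rewrite /partial_composition; move: (take _ _) => w.
  by elim: w x0 {opt t_le ex} => //= i w IH x; rewrite IH /trunc /lin !cellsE.
split=> // tau l _; rewrite !compE.
have -> : map val (take (nreg s 0) [seq sigma i | i <- enum 'I_n]) =
    map (narr s 0) (iota 0 (nreg s 0)).
  rewrite map_take -map_comp -[map _ _]/[seq val (sigma i) | i <- enum 'I_n] -OE -map_take.
  by rewrite take_iota (minn_idPl k_le).
apply: opt.
- by rewrite (map_inj_uniq val_inj) take_uniq // (map_inj_uniq perm_inj) enum_uniq.
- by move=> _ /mapP[i _ ->]; rewrite mem_iota add0n ltn_ord.
Qed.
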